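(* Consider the Markov decision process data, the perturbed linear program $(\mathrm{P}_\varepsilon)$ ($\varepsilon>0$), its feasible sets, and the linear program $(\mathrm{L})$ defined in the context. Then the following conditions hold: (a) there exist $\gamma_0>0$ and a bounded set $B$ such that the set $\theta^*(\varepsilon)$ of optimal solutions $(v,\sigma)$ of $(\mathrm{P}_\varepsilon)$ satisfies $\theta^*(\varepsilon)\subset B$ for every $\varepsilon\in(0,\gamma_0]$; (b) the constraint matrix $A^{(0)}$ of the equality constraints of $(\mathrm{P}_\varepsilon)$ at $\varepsilon=0$ has full row rank $m=\sum_{i=1}^N m_i$; (c) the extended Slater condition of order 1 holds: there exists $(\hat x^0,\hat x^1)\in\Theta_1$ with $\hat x^0_j>0$ for every $j\in J_0$ and $\hat x^1_j>0$ for every $j\notin J_0$. Hence $(\mathrm{L})$ is a limiting linear program for $(\mathrm{P}_\varepsilon)$ in the sense that $$\limsup_{\varepsilon\downarrow0}\theta^*(\varepsilon)\subset\theta_1^*\qquad\text{and}\qquad\lim_{\varepsilon\downarrow0}F^*(\varepsilon)=F_1^*,$$ where $F^*(\varepsilon)$ is the optimal value of $(\mathrm{P}_\varepsilon)$, $F_1^*$ is the optimal value of $(\mathrm{L})$, and $\theta_1^*$ is the set of all $(v^0,\sigma^0)$ for which there exists $(v^1,\sigma^1)$ such that $(v^0,\sigma^0,v^1,\sigma^1)$ is an optimal solution of $(\mathrm{L})$.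
   Context: Data: a finite state space $\mathbb{X}=\{1,\dots,N\}$; for each $i\in\mathbb{X}$ a finite action set $\mathbb{A}(i)=\{1,\dots,m_i\}$ ($m_i\ge1$); real rewards $r_{ia}$ and transition probabilities $p_{iaj}\ge0$ with $\sum_{j\in\mathbb{X}}p_{iaj}=1$, for $i,j\in\mathbb{X}$, $a\in\mathbb{A}(i)$; weights $\gamma_j>0$, $j\in\mathbb{X}$. ''For all $(i,a)$'' means for all $i\in\mathbb{X}$, $a\in\mathbb{A}(i)$. $\delta_{ij}$ is the Kronecker delta. Perturbed problem $(\mathrm{P}_\varepsilon)$, in the variables $v=(v_j)_{j\in\mathbb{X}}$, $\sigma=(\sigma_{ia})$ (this is the discounted-MDP linear program with $\varepsilon=(1-\alpha)/\alpha$, $\alpha\in(0,1)$ the discount factor): $$\min\ \sum_j\gamma_jv_j\quad\text{s.t.}\quad\sum_j[(1+\varepsilon)\delta_{ij}-p_{iaj}]v_j-\sigma_{ia}=\varepsilon r_{ia}\ \ \forall(i,a),\qquad v_j\ge0,\ \sigma_{ia}\ge0 .$$ Write $x=(v,\sigma)\in\mathbb{R}^n$, $n=N+m$, $m=\sum_i m_i$. The equality constraints have the form $(A^{(0)}+\varepsilon A^{(1)})x=b^{(0)}+\varepsilon b^{(1)}$ where, with rows indexed by $(i,a)$, $A^{(0)}=[\,(\delta_{ij}-p_{iaj})_{(i,a),j}\mid -I\,]$, $A^{(1)}=[\,(\delta_{ij})_{(i,a),j}\mid 0\,]$, $b^{(0)}=0$, $b^{(1)}=(r_{ia})$. Define $\theta(0)=\{x\in\mathbb{R}^n: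 A^{(0)}x=0,\ x\ge0\}$; $J_0$ = set of coordinate indices $k\in\{1,\dots,n\}$ for which some $x\in\theta(0)$ has $x_k>0$; and $$\Theta_1=\{(x^0,x^1)\in\mathbb{R}^n\times\mathbb{R}^n: x^0\in\theta(0),\ A^{(0)}x^1+A^{(1)}x^0=b^{(1)},\ x^1_j\ge0\ \forall j\notin J_0\}.$$ Problem $(\mathrm{L})$, in the variables $(v^0,\sigma^0,v^1,\sigma^1)$ (equivalent to the long-run average MDP linear program): $$\min\ \sum_j\gamma_jv^0_j\quad\text{s.t.}\quad\sum_j[\delta_{ij}-p_{iaj}]v^0_j-\sigma^0_{ia}=0\ \ \forall(i,a),\qquad v^0_i+\sum_j[\delta_{ij}-p_{iaj}]v^1_j-\sigma^1_{ia}=r_{ia}\ \ \forall(i,a),$$ $$v^0_j\ge0,\quad\sigma^0_{ia}\ge0,\quad v^1_j\ge0,\quad\sigma^1_{ia}\ge0 .$$ Here $\limsup_{\varepsilon\downarrow0}\theta^*(\varepsilon)$ is the Painlevé–Kuratowski outer limit: the set of all $x$ for which there exist $\varepsilon_k\downarrow0$ and $x_k\in\theta^*(\varepsilon_k)$ with $x_k\to x$. *)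

(* Defs.v *)
From mathcomp Require Import all_boot all_order all_algebra.
From mathcomp Require Import all_classical all_reals all_analysis.
Set Implicit Arguments.
Unset Strict Implicit.
Unset Printing Implicit Defensive.
Import Order.TTheory GRing.Theory Num.Theory.
Import numFieldNormedType.Exports.
Local Open Scope classical_set_scope.
Local Open Scope ring_scope.

Definition lp_argmin (R : realType) (T : Type) (f : T -> R) (S : set T) : set T :=
  [set x | S x /\ forall y, S y -> f x <= f y].

(* Extended-real valued, so that no junk value arises when [S] is empty or [f]
   is unbounded below on [S]. *)
Definition lp_value (R : realType) (T : Type) (f : T -> R) (S : set T) : \bar R :=
  ereal_inf [set (f x)%:E | x in S].

(* Painleve-Kuratowski outer limit of F(eps) as eps tends to 0 from the right. *)
Definition outer_limit0 (R : realType) (T : topologicalType) (F : R -> set T) :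
    set T :=
  [set x | exists (eps : nat -> R) (u : nat -> T),
    [/\ forall k, 0 < eps k, eps @ \oo --> (0 : R),
        forall k, F (eps k) (u k) & u @ \oo --> x]].

(* State-action pairs (i, a), with i : 'I_N and a : 'I_(m i), are numbered by
   tagnat.Rank : 'I_(m i) -> 'I_(\sum_i m i), whose inverse is given by
   tagnat.sig1 (the state) and tagnat.sig2 (the action). *)
Definition npairs (N : nat) (m : 'I_N -> nat) : nat := (\sum_(i < N) m i)%N.

Section MDP.
Context (R : realType) (N : nat) (m : 'I_N -> nat).
Context (r : forall i : 'I_N, 'I_(m i) -> R).
Context (p : forall i : 'I_N, 'I_(m i) -> 'I_N -> R).
Context (gamma : 'I_N -> R).

Local Notation vec := 'cV[R]_(N + npairs m).

Definition spair (i : 'I_N) (a : 'I_(m i)) : 'I_(npairs m) :=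
  @tagnat.Rank N m i a.

Definition vpart (x : vec) (j : 'I_N) : R := x (lshift (npairs m) j) 0.

Definition spart (x : vec) (i : 'I_N) (a : 'I_(m i)) : R :=
  x (rshift N (spair a)) 0.

Definition kdelta (i j : 'I_N) : R := (i == j)%:R.

Definition A0 : 'M[R]_(npairs m, N + npairs m) :=
  row_mx (\matrix_(k, j) (kdelta (tagnat.sig1 k) j - p (tagnat.sig2 k) j))
         (- 1%:M).

Definition A1 : 'M[R]_(npairs m, N + npairs m) :=
  row_mx (\matrix_(k, j) kdelta (tagnat.sig1 k) j) 0.

Definition b1 : 'cV[R]_(npairs m) := \col_k r (tagnat.sig2 k).

Definition P_feasible (eps : R) : set vec :=
  [set x | [/\ forall (i : 'I_N) (a : 'I_(m i)),
                 \sum_(j < N) ((1 + eps) * kdelta i j - p a j) * vpart x j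
                   - spart x a = eps * r a,
               forall j, 0 <= vpart x j
             & forall (i : 'I_N) (a : 'I_(m i)), 0 <= spart x a]].

Definition P_obj (x : vec) : R := \sum_(j < N) gamma j * vpart x j.

Definition theta_star (eps : R) : set vec := lp_argmin P_obj (P_feasible eps).

Definition F_star (eps : R) : \bar R := lp_value P_obj (P_feasible eps).

Definition theta0 : set vec := [set x | A0 *m x = 0 /\ forall k, 0 <= x k 0].

Definition J0 : set 'I_(N + npairs m) :=
  [set k | exists2 x, theta0 x & 0 < x k 0].

Definition Theta1 : set (vec * vec) :=
  [set x | [/\ theta0 x.1, A0 *m x.2 + A1 *m x.1 = b1
             & forall k, ~ J0 k -> 0 <= x.2 k 0]].

Definition ext_slater1 : Prop :=
  exists2 x, Theta1 x &
    (forall k, J0 k -> 0 < x.1 k 0) /\ (forall k, ~ J0 k -> 0 < x.2 k 0).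

Definition L_feasible : set (vec * vec) :=
  [set x | [/\ forall (i : 'I_N) (a : 'I_(m i)),
                 \sum_(j < N) (kdelta i j - p a j) * vpart x.1 j
                   - spart x.1 a = 0,
               forall (i : 'I_N) (a : 'I_(m i)),
                 vpart x.1 i + \sum_(j < N) (kdelta i j - p a j) * vpart x.2 j
                   - spart x.2 a = r a,
               (forall j, 0 <= vpart x.1 j) /\
               (forall (i : 'I_N) (a : 'I_(m i)), 0 <= spart x.1 a)
             & (forall j, 0 <= vpart x.2 j) /\
               (forall (i : 'I_N) (a : 'I_(m i)), 0 <= spart x.2 a)]].

Definition L_obj (x : vec * vec) : R := P_obj x.1.

Definition theta1_star : set vec :=
  [set x0 | exists x1, lp_argmin L_obj L_feasible (x0, x1)].

Definition F1_star : \bar R := lp_value L_obj L_feasible.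

Lemma Rank_forall (T : Type) (f g : forall i : 'I_N, 'I_(m i) -> T) :
  (forall k : 'I_(npairs m), f _ (tagnat.sig2 k) = g _ (tagnat.sig2 k)) ->
  forall (i : 'I_N) (a : 'I_(m i)), f i a = g i a.
Proof.
move=> fg i a; have := fg (spair a); rewrite /tagnat.sig1 /tagnat.sig2.
by rewrite /spair /tagnat.Rank tagnat.rankK.
Qed.

Lemma mulA0E (x : vec) k :
  (A0 *m x) k 0 =
  \sum_(j < N) (kdelta (tagnat.sig1 k) j - p (tagnat.sig2 k) j) * vpart x j
    - spart x (tagnat.sig2 k).
Proof.
rewrite -[x in LHS]vsubmxK mul_row_col mulNmx mul1mx !mxE; congr (_ - _).
  by apply: eq_bigr => j _; rewrite !mxE.
by rewrite /spart /spair tagnat.sig2K.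
Qed.

Lemma mulA1E (x : vec) k : (A1 *m x) k 0 = vpart x (tagnat.sig1 k).
Proof.
rewrite -[x in LHS]vsubmxK mul_row_col mul0mx addr0 mxE.
rewrite (bigD1 (tagnat.sig1 k)) //= !mxE /kdelta eqxx mul1r big1 ?addr0 // => j.
by rewrite !mxE eq_sym => /negPf ->; rewrite mul0r.
Qed.

Lemma vec_ge0P (x : vec) :
  (forall k, 0 <= x k 0) <->
  (forall j, 0 <= vpart x j) /\
  (forall (i : 'I_N) (a : 'I_(m i)), 0 <= spart x a).
Proof.
split=> [x0|[v0 s0] k]; first by split=> *; exact: x0.
case: (splitP k) => l e.
  by rewrite (_ : k = lshift _ l); [exact: v0 | exact: val_inj].
rewrite (_ : k = rshift N l); last exact: val_inj.
by have := s0 _ (tagnat.sig2 l); rewrite /spart /spair tagnat.sig2K.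
Qed.

Lemma P_feasibleE (eps : R) (x : vec) :
  P_feasible eps x <->
  (A0 + eps *: A1) *m x = eps *: b1 /\ (forall k, 0 <= x k 0).
Proof.
have rowE k : ((A0 + eps *: A1) *m x) k 0 =
    \sum_(j < N) ((1 + eps) * kdelta (tagnat.sig1 k) j - p (tagnat.sig2 k) j)
      * vpart x j - spart x (tagnat.sig2 k).
  rewrite mulmxDl -scalemxAl mxE mulA0E [X in _ + X]mxE mulA1E addrAC.
  congr (_ - _).
  rewrite [X in _ = X](eq_bigr (fun j =>
    (kdelta (tagnat.sig1 k) j - p (tagnat.sig2 k) j) * vpart x j
    + eps * (kdelta (tagnat.sig1 k) j * vpart x j))); last first.
    by move=> j _; rewrite [(1 + eps) * _]mulrDl mul1r addrAC [LHS]mulrDl mulrA.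
  rewrite big_split /= -mulr_sumr; congr (_ + eps * _).
  rewrite (bigD1 (tagnat.sig1 k)) //= /kdelta eqxx mul1r big1 ?addr0 // => j.
  by rewrite eq_sym => /negPf ->; rewrite mul0r.
split=> [[eqx v0 s0]|[eqx /vec_ge0P[v0 s0]]].
  split; last exact/vec_ge0P.
  by apply/matrixP => k l; rewrite ord1 rowE eqx !mxE.
split=> //; apply: (Rank_forall (f := fun i a => _ - _)) => k.
by rewrite -rowE eqx !mxE.
Qed.

Lemma L_feasibleE (x : vec * vec) :
  L_feasible x <->
  [/\ A0 *m x.1 = 0, A0 *m x.2 + A1 *m x.1 = b1,
      forall k, 0 <= x.1 k 0 & forall k, 0 <= x.2 k 0].
Proof.
split=> [[e0 e1 /vec_ge0P x0 /vec_ge0P x1]|[e0 e1 /vec_ge0P x0 /vec_ge0P x1]].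
  split=> //; apply/matrixP => k l; rewrite ord1.
    by rewrite mulA0E e0 mxE.
  by rewrite mxE mulA0E mulA1E addrC addrA e1 mxE.
split=> //.
  apply: (Rank_forall (f := fun i a => _ - _)) => k.
  by rewrite -mulA0E e0 mxE.
apply: (Rank_forall (f := fun i a => _ - _)) => k.
by rewrite -addrA -mulA0E -mulA1E addrC; move/matrixP: e1 => /(_ k 0); rewrite !mxE.
Qed.

End MDP.

(* Main.v *)
Require Import Defs.
From mathcomp Require Import all_boot all_order all_algebra.
From mathcomp Require Import all_classical all_reals all_analysis.
From mathcomp Require Import ring lra.
Import Order.TTheory GRing.Theory Num.Theory.
Import numFieldNormedType.Exports.
Local Open Scope classical_set_scope.
Local Open Scope ring_scope.

(** Write the constraints of (P_eps) as (A0 + eps A1) x = eps b1, x >= 0, and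
    those of (L) as A0 x0 = 0, A0 x1 + A1 x0 = b1, x0 >= 0, x1 >= 0.

    From (L) to (P_eps): if (x0, x1) is feasible for (L), then x0 + eps x1
    satisfies the equations of (P_eps) up to the term eps^2 A1 x1 >= 0. Since
    A0 contains the block - I and A1 vanishes on the slack variables, the
    slacks absorb this term exactly ([L_feasible_perturb]). So each feasible
    point of (L) is matched by feasible points of (P_eps) whose objective
    differs by O(eps), and limsup F*(eps) <= F1*. The same construction
    applied to a constant v0, which A0 annihilates because every p_ia is a
    probability distribution, bounds the optimal values of (P_eps), hence its
    optimal solutions as gamma > 0 ([theta_star_bounded]).

    From (P_eps) to (L): if x is feasible for (P_eps), dividing the
    constraints by eps gives A0 (x / eps) = b1 - A1 x, so that b1 - A1 x lies
    in the cone A0 (R^n_+). The quotient x / eps need not stay bounded as eps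
    tends to 0, but the membership itself survives the limit because a
    finitely generated cone is closed ([cone_closed]). Hence every limit x0 of
    feasible points of (P_eps) has b1 - A1 x0 = A0 x1 for some x1 >= 0, that
    is, extends to a feasible point of (L) ([P_graph_closed], [P_graph0]).
    Note that x1 >= 0 holds in all coordinates, as (L) demands, and not only
    outside J0.

    Together with the first part this makes limits of optimal solutions
    optimal for (L), and a compactness argument on bounded sublevel sets
    ([P_obj_lower_near]) gives liminf F*(eps) >= F1*. *)

(** * Finitely generated cones are closed *)

Definition supp {R : realType} {n : nat} (x : 'cV[R]_n) : {set 'I_n} :=
  [set k | x k 0 != 0]%SET.

Lemma supp_sub0 (R : realType) (n : nat) (x y : 'cV[R]_n) i :
  supp y \subset supp x -> x i 0 = 0 -> y i 0 = 0.
Proof.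
move=> /fintype.subsetP/(_ i); rewrite !inE => yx xi; apply/eqP.
by apply: contraT => /yx; rewrite xi eqxx.
Qed.

(** Caratheodory's reduction step: moving from [x] along the kernel direction
    [d] until the first coordinate vanishes keeps the image under [A], the
    nonnegativity, and drops that coordinate from the support. *)
Lemma supp_shrink (R : realType) (k n : nat) (A : 'M[R]_(k, n)) (x d : 'cV_n) :
  (forall j, 0 <= x j 0) -> A *m d = 0 -> supp d \subset supp x ->
  (exists j, d j 0 < 0) ->
  exists y : 'cV_n,
    [/\ forall j, 0 <= y j 0, A *m y = A *m x & supp y \proper supp x].
Proof.
move=> x0 Ad sdx [j0 dj0].
(* The ratio test: the largest step that keeps all coordinates nonnegative. *)
case: (@arg_minP _ R _ j0 (fun j => d j 0 < 0) (fun j => x j 0 / - d j 0) dj0).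
move=> j dj jmin; set t := x j 0 / - d j 0 in jmin.
have t0 : 0 <= t by rewrite divr_ge0 ?x0 // oppr_ge0 ltW.
exists (x + t *: d); split.
- move=> i; rewrite !mxE; have [di|di] := ltP (d i 0) 0.
    have := jmin i di; rewrite ler_pdivlMr ?oppr_gt0 // mulrN.
    by rewrite addrC -subr_ge0 opprK addrC.
  by rewrite addr_ge0 ?x0 // mulr_ge0.
- by rewrite mulmxDr -scalemxAr Ad scaler0 addr0.
- apply/fintype.properP; split.
    apply/fintype.subsetP => i; rewrite !inE !mxE; apply: contraNneq => xi.
    by rewrite xi (supp_sub0 _ _ _ _ _ sdx xi) mulr0 addr0.
  exists j; first by apply: (fintype.subsetP sdx); rewrite inE lt_eqF.
  rewrite inE negbK !mxE /t invrN mulrN mulNr -mulrA mulVf ?mulr1 ?subrr //.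
  by rewrite lt_eqF.
Qed.

(** The coordinate projection onto the indices in [S]. *)
Definition suppmx {R : realType} {n : nat} (S : {set 'I_n}) : 'M[R]_n :=
  diag_mx (\row_j (j \in S)%:R).

Lemma suppmxE (R : realType) (n : nat) (S : {set 'I_n}) (x : 'cV[R]_n) j :
  (suppmx S *m x) j 0 = (j \in S)%:R * x j 0.
Proof. by rewrite mul_diag_mx !mxE. Qed.

(** A fixed matrix sending each [y] that is a combination of the columns of [A]
    indexed by [S] to the coefficients of one such combination.  Using a
    generalized inverse of the masked matrix avoids extracting a submatrix. *)
Definition supp_solver {R : realType} {k n : nat} (A : 'M[R]_(k, n))
    (S : {set 'I_n}) : 'M[R]_(n, k) :=
  suppmx S *m pinvmx (A *m suppmx S).

(** For [x] of minimal support [S] among the nonnegative preimages of [A *m x],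
    the columns of [A] indexed by [S] are independent, so that the solution
    computed linearly from [A *m x] is [x] itself.  If it is not, the difference
    of the two is a kernel direction along which the support can be shrunk. *)
Lemma cone_supp_solver (R : realType) (k n : nat) (A : 'M[R]_(k, n))
    (x : 'cV_n) :
  (forall j, 0 <= x j 0) ->
  exists S, let z := supp_solver A S *m (A *m x) in
    A *m z = A *m x /\ forall j, 0 <= z j 0.
Proof.
have [s sx] := ubnP #|supp x|; elim: s x sx => // s IH x xs x0.
set S := supp x; pose z := supp_solver A S *m (A *m x).
have DSx : suppmx S *m x = x.
  apply/colP => j; rewrite suppmxE inE.
  by case: eqP => [->|]; rewrite ?mulr0 ?mul1r.
have Az : A *m z = A *m x.
  have BK := mulmxKpV (submx_refl (A *m @suppmx R _ S)).
  by rewrite /z /supp_solver -DSx (mulmxA A (suppmx S) x) -[in RHS]BK !mulmxA.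
have szx : supp z \subset S.
  apply/fintype.subsetP => j; rewrite inE /z /supp_solver -mulmxA suppmxE.
  by case: (j \in S); rewrite // mul0r eqxx.
have [zx|zx] := eqVneq z x.
  by exists S; rewrite -/z zx; split.
clearbody z.
have [y [y0 Ay yx]] : exists y : 'cV_n,
    [/\ forall j, 0 <= y j 0, A *m y = A *m x & supp y \proper supp x].
  (* [supp_shrink] needs a negative coordinate: one of the two opposite
     directions has it. *)
  have [j /eqP zxj] : exists j, z j 0 <> x j 0.
    apply/existsNP => zxE; move/eqP: zx; apply; apply/colP => j.
    exact: zxE.
  have sd : supp (z - x) \subset supp x.
    apply/fintype.subsetP => i; rewrite !inE !mxE; apply: contraNneq => xi.
    by rewrite xi subr0 (supp_sub0 _ _ _ _ _ szx xi).
  case: (ltgtP (z j 0) (x j 0)) zxj => // zxj _.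
    apply: (supp_shrink _ _ _ A x (z - x)) => //.
      by rewrite mulmxBr Az subrr.
    by exists j; rewrite !mxE subr_lt0.
  apply: (supp_shrink _ _ _ A x (x - z)) => //.
  - by rewrite mulmxBr Az subrr.
  - apply: fintype.subset_trans sd; apply/fintype.subsetP => i.
    by rewrite !inE !mxE -opprB oppr_eq0.
  - by exists j; rewrite !mxE subr_lt0.
rewrite -Ay; apply: IH => //.
by rewrite -ltnS (leq_trans _ xs) // ltnS proper_card.
Qed.

Lemma continuous_linear_form (R : realType) (n : nat) (I : finType)
    (c : I -> R) (f : I -> 'I_n) :
  continuous (fun x : 'cV[R]_n => \sum_i c i * x (f i) 0).
Proof.
apply: (continuous_big (@pseudometric_normed_Zmodule.add_continuous R R)).
move=> i _ x; apply: (@cvgM _ _ (nbhs x) _ (fun=> c i) (fun y => y (f i) 0)).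
  exact: cvg_cst.
exact: coord_continuous.
Qed.

Lemma continuous_mulmx_entry (R : realType) (k n : nat) (A : 'M[R]_(k, n)) i :
  continuous (fun x : 'cV[R]_n => (A *m x) i 0).
Proof. by under eq_fun do rewrite mxE; exact: continuous_linear_form. Qed.

Definition cone {R : realType} {k n : nat} (A : 'M[R]_(k, n)) : set 'cV[R]_k :=
  [set A *m x | x in [set x : 'cV[R]_n | forall j, 0 <= x j 0]].

(** The cone is the union, over the finitely many supports [S], of the sets of
    [y] for which the candidate [supp_solver A S *m y] is nonnegative and really
    solves the system; each is cut out by linear equations and inequalities. *)
Lemma cone_closed (R : realType) (k n : nat) (A : 'M[R]_(k, n)) :
  closed (cone A).
Proof.
have -> : cone A = \bigcup_(S in [set: {set 'I_n}])
    ([set y | forall i, (A *m supp_solver A S *m y - 1%:M *m y) i 0 = 0] `&`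
     [set y | forall j, 0 <= (supp_solver A S *m y) j 0]).
  apply/seteqP; split=> [_ [x x0 <-]|y [S _ [/= eqy y0]]].
    have [S [eqz z0]] := cone_supp_solver R k n A x x0.
    by exists S => //; split=> // i; rewrite /= -mulmxA eqz mul1mx subrr mxE.
  exists (supp_solver A S *m y) => //; apply/colP => i; apply/eqP.
  by rewrite -subr_eq0 -(eqy i) mul1mx mulmxA !mxE.
apply: closed_bigcup => [|S _]; [exact: finite_finset | apply: closedI].
  rewrite (_ : mkset _ = \bigcap_i [set y : 'cV[R]_k |
    ((A *m supp_solver A S - 1%:M) *m y) i 0 = 0]); last first.
    by apply/seteqP; split=> y /= yE i *; have := yE i;
      rewrite /= mulmxBl => ->.
  apply: closed_bigI => i _.
  exact: ((continuous_closedP _).1 (@continuous_mulmx_entry _ _ _ _ i) _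
           (@closed_eq R 0)).
rewrite (_ : mkset _ = \bigcap_j [set y : 'cV[R]_k |
  0 <= (supp_solver A S *m y) j 0]); last first.
  by apply/seteqP; split=> y /= yE i *; apply: yE.
apply: closed_bigI => i _.
exact: ((continuous_closedP _).1 (@continuous_mulmx_entry _ _ _ _ i) _
         (@closed_ge R 0)).
Qed.

(** * Compact boxes of column vectors *)

Lemma cvg_mx (R : realType) (T : Type) (F : set_system T) {FF : Filter F}
    (k n : nat) (f : T -> 'M[R]_(k, n)) (l : 'M[R]_(k, n)) :
  (forall i j, f t i j @[t --> F] --> l i j) -> f @ F --> l.
Proof.
move=> fl; apply/cvg_ballP => e e0.
have : \forall t \near F, forall i j, ball (l i j) e (f t i j).
  apply: filter_forall => i; apply: filter_forall => j.
  by have /cvg_ballP := fl i j; exact.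
by apply: filterS => t ft; split.
Qed.

Definition box {R : realType} (n : nat) (M : R) : set 'cV[R]_n :=
  [set x | forall k, 0 <= x k 0 <= M].

Lemma compact_box (R : realType) (n : nat) (M : R) : compact (box n M).
Proof.
have -> : box n M = [set x^T | x in
    [set x : 'rV[R]_n | forall k, `[0, M]%classic (x ord0 k)]].
  apply/seteqP; split=> [x xM|_ [x xM <-] k].
    exists x^T; last exact: trmxK.
    by move=> k; rewrite /= mxE in_itv; exact: xM.
  by have := xM k; rewrite /= in_itv mxE.
have trC : continuous (fun x : 'rV[R]_n => x^T).
  move=> x; apply: (@cvg_mx _ _ (nbhs x)) => i j; rewrite mxE.
  by under eq_fun do rewrite mxE; exact: coord_continuous.
apply: (continuous_compact (continuous_subspaceT trC)).
apply: (@rV_compact R n (fun=> `[0, M]%classic)) => _.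
exact: segment_compact.
Qed.

(** * Perturbing feasible points of the limiting program *)

Section MarkovDecisionLP.
Context (R : realType) (N : nat) (m : 'I_N -> nat).
Context (r : forall i : 'I_N, 'I_(m i) -> R).
Context (p : forall i : 'I_N, 'I_(m i) -> 'I_N -> R).
Context (gamma : 'I_N -> R).
Local Notation vec := 'cV[R]_(N + npairs m).

Definition slackv (s : 'cV[R]_(npairs m)) : vec := col_mx 0 s.

Definition constv (c : R) : vec := col_mx (const_mx c) 0.

Lemma mulA0_slackv s : A0 p *m slackv s = - s.
Proof. by rewrite mul_row_col mulmx0 add0r mulNmx mul1mx. Qed.

Lemma mulA1_slackv s : A1 R m *m slackv s = 0.
Proof. by rewrite mul_row_col mulmx0 add0r mul0mx. Qed.

Lemma P_obj_slackv s : P_obj gamma (slackv s) = 0.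
Proof.
by rewrite /P_obj big1 // => j _; rewrite /vpart col_mxEu mxE mulr0.
Qed.

Lemma P_objD (x y : vec) : P_obj gamma (x + y) = P_obj gamma x + P_obj gamma y.
Proof.
by rewrite /P_obj -big_split; apply: eq_bigr => j _; rewrite /vpart mxE mulrDr.
Qed.

Lemma P_objZ c (x : vec) : P_obj gamma (c *: x) = c * P_obj gamma x.
Proof.
rewrite /P_obj mulr_sumr; apply: eq_bigr => j _.
by rewrite /vpart mxE mulrCA.
Qed.

Lemma slackv_ge0 (s : 'cV[R]_(npairs m)) :
  (forall k, 0 <= s k 0) -> forall k, 0 <= slackv s k 0.
Proof.
move=> s0 k; rewrite mxE; case: (fintype.split k) => j; first by rewrite mxE.
exact: s0.
Qed.

Lemma constv_ge0 c : 0 <= c -> forall k, 0 <= constv c k 0.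
Proof.
by move=> c0 k; rewrite mxE; case: (fintype.split k) => j; rewrite mxE.
Qed.

Lemma mulA1_constv c k : (A1 R m *m constv c) k 0 = c.
Proof. by rewrite mulA1E /vpart col_mxEu mxE. Qed.

Lemma mulA0_constv c :
  (forall (i : 'I_N) (a : 'I_(m i)), \sum_(j < N) p i a j = 1) ->
  A0 p *m constv c = 0.
Proof.
move=> p1; apply/colP => k; rewrite mulA0E /spart col_mxEd !mxE subr0.
rewrite (eq_bigr (fun j => (kdelta R (tagnat.sig1 k) j
   - p _ (tagnat.sig2 k) j) * c)); last first.
  by move=> j _; rewrite /vpart col_mxEu mxE.
rewrite -mulr_suml sumrB p1 (bigD1 (tagnat.sig1 k)) //= big1 => [|j].
  by rewrite /kdelta eqxx addr0 subrr mul0r.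
by rewrite /kdelta eq_sym => /negPf ->.
Qed.

Lemma rank_A0 : \rank (A0 p) = npairs m.
Proof.
apply/eqP; rewrite -[_ == _]/(row_free _); apply/row_freeP.
exists (col_mx 0 (- 1%:M)).
by rewrite mul_row_col mulmx0 add0r mulmxN mulNmx opprK mulmx1.
Qed.

(** A crude bound on all the absolute rewards; unlike a maximum, the sum needs
    no default value. *)
Definition rbound : R := \sum_k `|b1 r k 0|.

Lemma rbound_ge k : b1 r k 0 <= rbound.
Proof.
rewrite /rbound (bigD1 k) //= (le_trans (ler_norm _)) // lerDl.
by rewrite sumr_ge0.
Qed.

Lemma rbound_geN k : - b1 r k 0 <= rbound.
Proof.
rewrite /rbound (bigD1 k) //= (le_trans (ler_norm _)) // normrN lerDl.
by rewrite sumr_ge0.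
Qed.

Lemma rbound_ge0 : 0 <= rbound. Proof. exact: sumr_ge0. Qed.

(** With all [v1] equal to zero, the first-order equation of (L) is solved
    uniquely by these slack values, whatever [x] is.  Their sign is the only
    issue, and adding a large constant to the [v] part of [x] settles it. *)
Definition order1_slack (x : vec) : vec := slackv (A1 R m *m x - b1 r).

Lemma order1_slackP (x : vec) :
  A0 p *m order1_slack x + A1 R m *m x = b1 r.
Proof. by rewrite mulA0_slackv opprB subrK. Qed.

Lemma L_feasible_const :
  (forall (i : 'I_N) (a : 'I_(m i)), \sum_(j < N) p i a j = 1) ->
  L_feasible r p (constv rbound, order1_slack (constv rbound)).
Proof.
move=> p_sum1; apply/L_feasibleE; split=> /=; first exact: mulA0_constv.
- exact: order1_slackP.
- exact: constv_ge0 rbound_ge0.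
- by apply: slackv_ge0 => k; rewrite mxE mulA1_constv mxE subr_ge0 rbound_ge.
Qed.

(** The naive perturbation [z.1 + eps *: z.2] misses the equations of (P_eps)
    by [eps ^+ 2 *: (A1 *m z.2)].  This defect is nonnegative because [z.2] is,
    so it can be put into the slacks, which carry no cost. *)
Lemma L_feasible_perturb (z : vec * vec) (eps : R) :
  L_feasible r p z -> 0 <= eps ->
  exists2 y, P_feasible r p eps y &
    P_obj gamma y = P_obj gamma z.1 + eps * P_obj gamma z.2.
Proof.
move=> /L_feasibleE[Az0 Az1 z10 z20] eps0.
exists (z.1 + eps *: z.2 + eps ^+ 2 *: slackv (A1 R m *m z.2)); last first.
  by rewrite !P_objD !P_objZ P_obj_slackv mulr0 addr0.
apply/P_feasibleE; split.
  rewrite mulmxDl !mulmxDr -!scalemxAl -!scalemxAr mulA0_slackv mulA1_slackv.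
  rewrite Az0 add0r !scaler0 addr0 -Az1 scalerN scalerA -expr2.
  by rewrite addrACA addNr addr0 -scalerDr.
move=> k; rewrite mxE [X in X + _]mxE [X in _ + X + _]mxE [X in _ + X]mxE.
rewrite !addr_ge0 ?mulr_ge0 ?exprn_ge0 //.
apply: slackv_ge0 => i; rewrite mulA1E.
by have [/(_ (tagnat.sig1 i))] := (vec_ge0P z.2).1 z20.
Qed.

(** Positivity of [gamma] and of [v] turns a bound on the objective into one on
    each [v j], and the constraints then bound the slacks. *)
Lemma P_feasible_box (eps C : R) (x : vec) :
  (forall (i : 'I_N) (a : 'I_(m i)) (j : 'I_N), 0 <= p i a j) ->
  (forall j, 0 < gamma j) ->
  0 <= eps <= 1 -> P_feasible r p eps x -> P_obj gamma x <= C ->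
  box _ (2 * (\sum_j C / gamma j) + rbound) x.
Proof.
move=> p_ge0 gamma_gt0 /andP[e0 e1] [eqx v0 s0] objC.
have vC j : vpart x j <= C / gamma j.
  rewrite ler_pdivlMr // mulrC; apply: le_trans objC.
  rewrite /P_obj (bigD1 j) //= lerDl sumr_ge0 // => i _.
  by rewrite mulr_ge0 ?v0 // ltW.
have C0 j : 0 <= C / gamma j by exact: le_trans (vC j).
set B := \sum_j _; have B0 : 0 <= B by exact: sumr_ge0.
have vB j : vpart x j <= B.
  by apply: le_trans (vC j) _; rewrite /B (bigD1 j) //= lerDl sumr_ge0.
have sB k : spart x (tagnat.sig2 k) <= 2 * B + rbound.
  have -> : spart x (tagnat.sig2 k) = \sum_(j < N)
      ((1 + eps) * kdelta R (tagnat.sig1 k) j - p _ (tagnat.sig2 k) j)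
      * vpart x j + eps * - b1 r k 0 by rewrite mxE mulrN -eqx; ring.
  apply: lerD.
    rewrite /B mulr_sumr; apply: ler_sum => j _.
    apply: (@le_trans _ _ (2 * vpart x j)); last by rewrite ler_wpM2l.
    apply: ler_wpM2r (v0 j) _ _ _.
    have := p_ge0 _ (tagnat.sig2 k) j; rewrite /kdelta.
    by case: (_ == j); rewrite ?mulr1 ?mulr0; lra.
  apply: le_trans (ler_wpM2l e0 (rbound_geN k)) _.
  by rewrite ler_piMl // rbound_ge0.
move=> k; rewrite (vec_ge0P x).2 //=.
case: (split_ordP k) => j -> {k}.
  by have := vB j; have := rbound_ge0; rewrite /vpart; lra.
by have := sB j; rewrite /spart /spair tagnat.sig2K.
Qed.

(** * Limits of feasible points *)

(** A closed set that contains the graph of [P_feasible] over positive [eps],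
    and whose slice at [eps = 0] consists of the first components of feasible
    points of (L).  The first-order equation of (L) is a trace left at [eps = 0]
    by the equation divided by [eps]; the cone condition records it in a form
    that is closed and does not mention [eps]. *)
Definition P_graph : set (R * vec) :=
  [set z | [/\ forall k, (A0 p *m z.2) k 0
                 + z.1 * ((A1 R m *m z.2) k 0 - b1 r k 0) = 0,
               forall k, 0 <= z.2 k 0
             & cone (A0 p) (b1 r - A1 R m *m z.2)]].

Lemma P_graph_closed : closed P_graph.
Proof.
have c2 (f : vec -> R) : continuous f -> continuous (fun z : R * vec => f z.2).
  move=> cf z; apply: (@continuous_comp _ _ _ snd f); first exact: cvg_snd.
  exact: cf.
have -> : P_graph =
    (\bigcap_k [set z : R * vec | (A0 p *m z.2) k 0
                 + z.1 * ((A1 R m *m z.2) k 0 - b1 r k 0) = 0]) `&`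
    (\bigcap_k [set z : R * vec | 0 <= z.2 k 0]) `&`
    [set z : R * vec | cone (A0 p) (b1 r - A1 R m *m z.2)].
  apply/seteqP; split=> z /=.
    by move=> [z1 z2 z3]; split=> //; split=> k _; [exact: z1|exact: z2].
  by move=> [[z1 z2] z3]; split=> // k; [exact: z1 | exact: z2].
apply: closedI; first apply: closedI.
- apply: closed_bigI => k _.
  apply: ((continuous_closedP (fun z : R * vec => (A0 p *m z.2) k 0
    + z.1 * ((A1 R m *m z.2) k 0 - b1 r k 0))).1 _ _ (@closed_eq R 0)) => z.
  apply: cvgD; first exact: (c2 _ (continuous_mulmx_entry _ _ _ _ k)).
  apply: cvgM; first exact: cvg_fst.
  apply: cvgB; last exact: cvg_cst.
  exact: (c2 _ (continuous_mulmx_entry _ _ _ _ k)).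
- apply: closed_bigI => k _.
  apply: ((continuous_closedP (fun z : R * vec => z.2 k 0)).1 _ _
    (@closed_ge R 0)).
  by apply: (c2 (fun x => x k 0)); exact: coord_continuous.
- apply: ((continuous_closedP (fun z : R * vec => b1 r - A1 R m *m z.2)).1 _ _
    (cone_closed _ _ _ (A0 p))) => z.
  apply: (@cvg_mx _ _ (nbhs z)) => i j; rewrite ord1 mxE [X in _ + X]mxE.
  under eq_fun do rewrite mxE [X in _ + X]mxE.
  apply: cvgB; first exact: cvg_cst.
  exact: (c2 _ (continuous_mulmx_entry _ _ _ _ i)).
Qed.

Lemma P_graph_feasible (eps : R) (x : vec) :
  0 < eps -> P_feasible r p eps x -> P_graph (eps, x).
Proof.
move=> e0 /P_feasibleE[eqx x0].
have eqA : A0 p *m x = eps *: (b1 r - A1 R m *m x).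
  by rewrite scalerBr -eqx mulmxDl -scalemxAl addrK.
split=> //= [k|].
  rewrite eqA mxE [X in _ * X + _]mxE [X in _ * (_ + X) + _]mxE.
  by rewrite -mulrDr addrC subrKA subrr mulr0.
exists (eps^-1 *: x) => [k|]; first by rewrite mxE mulr_ge0 // invr_ge0 ltW.
by rewrite -scalemxAr eqA scalerA mulVf ?scale1r // gt_eqF.
Qed.

Lemma P_graph0 (x : vec) : P_graph (0, x) -> exists x1, L_feasible r p (x, x1).
Proof.
move=> [/= A0x x0 [x1 x10 Ax1]]; exists x1; apply/L_feasibleE; split=> //=.
  by apply/colP => k; have := A0x k; rewrite mul0r addr0 => ->; rewrite mxE.
by rewrite Ax1 subrK.
Qed.

Lemma continuous_P_obj : continuous (P_obj gamma : vec -> R).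
Proof. exact: continuous_linear_form. Qed.

(** Feasible points of value at most [c] lie in a fixed compact box.  Each point
    of the box has a neighbourhood free of them for small [eps]: either it
    extends to a feasible point of (L), and the objective exceeds [c] around
    it, or [(0, x)] is outside the closed set [P_graph].  Compactness makes the
    range of [eps] uniform. *)
Lemma P_obj_lower_near (c : R) :
  (forall (i : 'I_N) (a : 'I_(m i)) (j : 'I_N), 0 <= p i a j) ->
  (forall j, 0 < gamma j) ->
  (forall z, L_feasible r p z -> c < P_obj gamma z.1) ->
  \forall eps \near 0^'+, forall x, P_feasible r p eps x -> c < P_obj gamma x.
Proof.
move=> p_ge0 gamma_gt0 Lc.
set M := 2 * (\sum_j c / gamma j) + rbound.
have /compact_near_coveringP boxM := compact_box R (N + npairs m) M.
have Kc : \forall eps \near 0^'+,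
    box _ M `<=` [set x | 0 < eps -> P_feasible r p eps x -> c < P_obj gamma x].
  apply: boxM => x _.
  have [Gx|nGx] := pselect (P_graph (0, x)).
    have [x1 /Lc/= cx] := P_graph0 x Gx.
    have cy : \forall y \near x, c < P_obj gamma y.
      exact: (continuous_P_obj x _ (lt_nbhsr cx)).
    by exists ([set y | c < P_obj gamma y], setT) => [|[y e] [/= cy' _]];
      [split=> //=; exact: filterT|].
  have [[U V] /= [U0 Vx] UV] : nbhs ((0 : R), x) (~` P_graph).
    apply: open_nbhs_nbhs; split=> //.
    by apply: closed_openC; exact: P_graph_closed.
  exists (V, U) => [|[y e] [/= Vy Ue] e0 /(P_graph_feasible e y e0) Gy].
    by split=> //=; apply: cvg_at_right_filter U0; exact: cvg_id.
  by suff : (~` P_graph) (e, y) by []; exact: UV.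
near=> e => x xP; rewrite ltNge; apply/negP => xc.
have e0 : 0 < e by near: e; exact: nbhs_right_gt.
have e1 : e <= 1 by near: e; exact: nbhs_right_le.
have bx : box _ M x.
  by apply: (P_feasible_box e) => //; rewrite (ltW e0).
have : c < P_obj gamma x by move: x bx xP {xc} => x bx; apply: (near Kc e).
by rewrite ltNge xc.
Unshelve. all: end_near. Qed.

(** The sum of one witness for each index of [J0] is positive on all of [J0]: it
    stays in the convex cone [theta0], whose elements have no negative
    coordinate that could cancel a positive one. *)
Lemma J0_positive_point : exists2 x, theta0 p x & forall k, J0 p k -> 0 < x k 0.
Proof.
have ex k : exists x, theta0 p x /\ (J0 p k -> 0 < x k 0).
  have [[x xt x0]|nJ] := pselect (J0 p k); first by exists x.
  exists 0; split=> //; split; first by rewrite mulmx0.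
  by move=> j; rewrite mxE.
have [f fP] := choice ex.
have f0 k j : 0 <= f k j 0 by have [[_ +] _] := fP k; exact.
exists (\sum_k f k) => [|k Jk].
  split; first by rewrite mulmx_sumr big1 // => k _; have [[]] := fP k.
  by move=> j; rewrite summxE sumr_ge0.
rewrite summxE (bigD1 k) //= ltr_wpDr ?sumr_ge0 //.
by have [_ /(_ Jk)] := fP k.
Qed.

(** All the [v] coordinates belong to [J0], because [theta0] contains the
    positive constant vectors.  Strict positivity of the first-order term is
    thus only required of slacks, and it is obtained by translating the [v] part
    of the zeroth-order term by a constant that exceeds all rewards. *)
Lemma ext_slater1_holds :
  (forall (i : 'I_N) (a : 'I_(m i)), \sum_(j < N) p i a j = 1) ->
  ext_slater1 r p.
Proof.
move=> p_sum1; have [x [Ax x0] xJ] := J0_positive_point.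
have c0 : 0 <= rbound + 1 by rewrite addr_ge0 ?rbound_ge0.
pose y := x + constv (rbound + 1).
have y0 : theta0 p y.
  split; first by rewrite mulmxDr Ax mulA0_constv ?addr0.
  by move=> k; rewrite mxE addr_ge0 ?x0 ?constv_ge0.
have slack_gt0 k : ~ J0 p k -> 0 < order1_slack y k 0.
  case: (split_ordP k) => j -> {k}.
    case; exists (constv 1); last by rewrite col_mxEu mxE.
    split; first exact: mulA0_constv.
    exact: constv_ge0.
  move=> _; rewrite col_mxEd mxE mulmxDr [(A1 R m *m x + _) j 0]mxE.
  rewrite mulA1_constv [(- b1 r) j 0]mxE.
  have := rbound_ge j; have : 0 <= (A1 R m *m x) j 0 by rewrite mulA1E x0.
  lra.
exists (y, order1_slack y).
  split=> //=; first exact: order1_slackP.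
  by move=> k /slack_gt0/ltW.
split=> k /=; last exact: slack_gt0.
by move=> /xJ xk; rewrite mxE ltr_wpDr ?constv_ge0.
Qed.

(** * Boundedness and convergence *)

Lemma theta_star_bounded :
  (forall (i : 'I_N) (a : 'I_(m i)) (j : 'I_N), 0 <= p i a j) ->
  (forall (i : 'I_N) (a : 'I_(m i)), \sum_(j < N) p i a j = 1) ->
  (forall j, 0 < gamma j) ->
  exists B : set vec, bounded_set B /\
    forall eps : R, 0 < eps <= 1 -> theta_star r p gamma eps `<=` B.
Proof.
move=> p_ge0 p_sum1 gamma_gt0.
pose C := P_obj gamma (constv rbound : vec).
exists (box _ (2 * (\sum_j C / gamma j) + rbound)); split.
  exact: compact_bounded (compact_box _ _ _).
move=> eps /andP[e0 e1] x [xP xmin].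
have [y yP yC] := L_feasible_perturb _ _ (L_feasible_const p_sum1) (ltW e0).
apply: (P_feasible_box eps) => //; first by rewrite (ltW e0).
by apply: le_trans (xmin y yP) _; rewrite yC /= P_obj_slackv mulr0 addr0.
Qed.

(** The limit is feasible for (L) by closedness of [P_graph].  For optimality,
    an arbitrary feasible point of (L) is compared with the limit through its
    perturbations, which compete with the optimal solutions of (P_eps). *)
Lemma outer_limit_theta_star :
  outer_limit0 (theta_star r p gamma) `<=` theta1_star r p gamma.
Proof.
move=> x [eps [u [eps0 epsl uP ul]]].
have [x1 Lx] : exists x1, L_feasible r p (x, x1).
  have graphP : \forall k \near \oo, P_graph (eps k, u k).
    apply: nearW => k; apply: P_graph_feasible => //.
    by have [] := uP k.
  apply: P_graph0.
  exact: (closed_cvg P_graph P_graph_closed graphP (0, x) (cvg_pair epsl ul)).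
exists x1; split=> // y Ly.
have uobj : P_obj gamma (u k) @[k --> \oo] --> P_obj gamma x.
  exact: cvg_comp ul (continuous_P_obj x).
have yobj : P_obj gamma y.1 + eps k * P_obj gamma y.2 @[k --> \oo] -->
    P_obj gamma y.1 + 0 * P_obj gamma y.2.
  by apply: cvgD; [exact: cvg_cst | apply: cvgM => //; exact: cvg_cst].
rewrite mul0r addr0 in yobj.
apply: (ler_cvg_to uobj yobj); apply: nearW => k.
have [w wP <-] := L_feasible_perturb _ _ Ly (ltW (eps0 k)).
by have [_ /(_ w wP)] := uP k.
Qed.

Lemma P_obj_ge0 (x : vec) :
  (forall j, 0 < gamma j) -> (forall j, 0 <= vpart x j) -> 0 <= P_obj gamma x.
Proof.
by move=> g0 v0; rewrite sumr_ge0 // => j _; rewrite mulr_ge0 // ltW.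
Qed.

(** The perturbation of a nearly optimal point of (L) bounds [F_star] from
    above, [P_obj_lower_near] bounds it from below. *)
Lemma F_star_cvg :
  (forall (i : 'I_N) (a : 'I_(m i)) (j : 'I_N), 0 <= p i a j) ->
  (forall (i : 'I_N) (a : 'I_(m i)), \sum_(j < N) p i a j = 1) ->
  (forall j, 0 < gamma j) ->
  F_star r p gamma eps @[eps --> 0^'+] --> F1_star r p gamma.
Proof.
move=> p_ge0 p_sum1 gamma_gt0.
have F1_fin : F1_star r p gamma \is a fin_num.
  rewrite fin_numE; apply/andP; split.
    rewrite gt_eqF // (@lt_le_trans _ _ 0%E) ?ltNy0 //.
    apply: le_ereal_inf_tmp => _ [z [_ _ [z0 _] _] <-].
    by rewrite lee_fin P_obj_ge0.
  rewrite lt_eqF //.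
  apply: le_lt_trans (ltry (P_obj gamma (constv rbound : vec))).
  apply: ereal_inf_lbound.
  exists (constv rbound, order1_slack (constv rbound)) => //.
  exact: L_feasible_const.
set f := fine (F1_star r p gamma).
have F1E : F1_star r p gamma = f%:E by rewrite fineK.
have F1_le z : L_feasible r p z -> f <= P_obj gamma z.1.
  by move=> Lz; rewrite -lee_fin -F1E; apply: ereal_inf_lbound; exists z.
have sandwich d : 0 < d -> \forall eps \near 0^'+,
    ((f - d)%:E <= F_star r p gamma eps <= (f + d)%:E)%E.
  move=> d0.
  have [_ [z Lz <-]] : exists2 y,
      [set (L_obj gamma x)%:E | x in L_feasible r p] y & (y < (f + d / 2)%:E)%E.
    apply: ereal_inf_lt; rewrite [X in (X < _)%E](_ : _ = f%:E) //.
    by rewrite lte_fin ltrDl divr_gt0.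
  rewrite lte_fin /L_obj => zf.
  have low := P_obj_lower_near (f - d) p_ge0 gamma_gt0.
  have z2 : 0 < P_obj gamma z.2 + 1.
    by case: Lz => _ _ _ [v0 _]; rewrite ltr_wpDl ?P_obj_ge0.
  near=> eps.
  have e0 : 0 < eps by near: eps; exact: nbhs_right_gt.
  apply/andP; split.
    apply: le_ereal_inf_tmp => _ [x xP <-]; rewrite lee_fin ltW //.
    move: x xP; near: eps; apply: low => w /F1_le; apply: lt_le_trans.
    by rewrite ltrBlDr ltrDl.
  have [y yP yE] := L_feasible_perturb _ _ Lz (ltW e0).
  apply: ge_ereal_inf; exists (P_obj gamma y)%:E; first by exists y.
  rewrite lee_fin yE.
  have : eps * (P_obj gamma z.2 + 1) <= d / 2.
    (* The added 1 keeps the divisor positive when the objective vanishes. *)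
    rewrite -ler_pdivlMr //; near: eps; apply: nbhs_right_le.
    by rewrite !divr_gt0.
  by move: zf e0; rewrite mulrDr mulr1; lra.
rewrite F1E; apply/fine_cvgP; split.
  have := sandwich 1 ltr01; apply: filterS => eps /andP[lo hi].
  by rewrite fin_numElt (lt_le_trans _ lo) ?ltNyr //= (le_lt_trans hi) ?ltry.
apply/cvgrPdist_le => d d0; have := sandwich d d0.
apply: filterS => eps /andP[lo hi] /=.
have Ffin : F_star r p gamma eps \is a fin_num.
  by rewrite fin_numElt (lt_le_trans _ lo) ?ltNyr //= (le_lt_trans hi) ?ltry.
move: lo hi; rewrite -(fineK Ffin) !lee_fin => lo hi.
by rewrite ler_norml; apply/andP; split; lra.
Unshelve. all: end_near. Qed.

End MarkovDecisionLP.

Theorem theorem2 (R : realType) (N : nat) (m : 'I_N -> nat)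
    (r : forall i : 'I_N, 'I_(m i) -> R)
    (p : forall i : 'I_N, 'I_(m i) -> 'I_N -> R)
    (gamma : 'I_N -> R)
    (N_gt0 : (0 < N)%N)
    (m_gt0 : forall i, (0 < m i)%N)
    (p_ge0 : forall (i : 'I_N) (a : 'I_(m i)) (j : 'I_N), 0 <= p i a j)
    (p_sum1 : forall (i : 'I_N) (a : 'I_(m i)), \sum_(j < N) p i a j = 1)
    (gamma_gt0 : forall j, 0 < gamma j) :
  [/\ (* (a) *)
      exists gamma0 : R, 0 < gamma0 /\
        exists B : set 'cV[R]_(N + npairs m), bounded_set B /\
          forall eps : R, 0 < eps <= gamma0 -> theta_star r p gamma eps `<=` B,
      (* (b) *)
      \rank (A0 p) = (\sum_(i < N) m i)%N,
      (* (c) *)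
      ext_slater1 r p
    & (* (L) is a limiting linear program *)
      outer_limit0 (theta_star r p gamma) `<=` theta1_star r p gamma /\
      F_star r p gamma eps @[eps --> 0^'+] --> F1_star r p gamma].
Proof.
split.
- exists 1; split; first exact: ltr01.
  exact: theta_star_bounded.
- exact: rank_A0.
- exact: ext_slater1_holds.
- split; first exact: outer_limit_theta_star.
  exact: F_star_cvg.
Qed.
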